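(* Let $T$ be a finite tree with at least one edge. Then the Morse complex $\mathcal{M}(T)$ has the homotopy type of a suspension; that is, there is a (possibly empty) space $X$ such that $\mathcal{M}(T)\simeq \Sigma X$.
   Context: A graph is a simplicial complex of dimension $1$; a tree is a connected acyclic graph. For a finite simplicial complex $K$, a discrete vector field on $K$ is a set $V$ of pairs $(\sigma^{(p)},\tau^{(p+1)})$ of simplices of $K$ with $\sigma$ a codimension-one face of $\tau$ (superscripts denote dimension), such that each simplex of $K$ is in at most one pair. A $V$-path is a sequence $\alpha_0^{(p)},\beta_0^{(p+1)},\alpha_1^{(p)},\beta_1^{(p+1)},\ldots,\beta_{k-1}^{(p+1)},\alpha_k^{(p)}$ of simplices with $(\alpha_i,\beta_i)\in V$ and $\beta_i>\alpha_{i+1}\neq\alpha_i$ for $0\le i\le k-1$; it is non-trivial if $k\neq 0$ and closed if $\alpha_k=\alpha_0$. A gradient vector field is a discrete vector field with no non-trivial closed $V$-paths; it is primitive if it consists of a single pair. The Morse complex $\mathcal{M}(K)$ is the simplicial complex whose vertices are the primitive gradient vector fields on $K$ and whose $n$-simplices are the gradient vector fields on $K$ with $n+1$ pairs, with face relation given by inclusion. $\Sigma X$ denotes the (unreduced) suspension, with the convention $\Sigma\emptyset=\mathbb{S}^0$. *)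

(* Defs.v *)
From HB Require Import structures.
From mathcomp Require Import all_boot all_order all_algebra generic_quotient.
From mathcomp Require Import all_classical all_reals all_analysis.

Set Implicit Arguments.
Unset Strict Implicit.
Unset Printing Implicit Defensive.

Import Order.TTheory GRing.Theory Num.Theory.
Import numFieldNormedType.Exports.

Local Open Scope ring_scope.

(* Simplices are the nonempty members of [faces], of dimension [#|s|.-1]; an
   element [v : V] is a vertex of the complex only when [[set v]] is a face. *)
Record simplicial_complex (V : finType) := SimplicialComplex {
  faces :> {set {set V}};
  faces_neq0 : finset.set0 \notin faces;
  faces_down (s t : {set V}) :
    s \in faces -> t \subset s -> t != finset.set0 -> t \in faces }.

Definition facet (V : finType) (K : simplicial_complex V) (s t : {set V}) :=
  [&& s \in faces K, t \in faces K, s \subset t & #|t| == #|s|.+1].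

Section Trees.
Variables (V : finType) (K : simplicial_complex V).

Definition adj : rel V :=
  fun x y => (x != y) && ([set x; y]%SET \in faces K).

Definition has_edge := exists2 e : {set V}, e \in faces K & #|e| = 2.

(* Dimension at most 1, so that a single vertex counts as a tree; together with
   [has_edge] the dimension is exactly 1. *)
Definition is_graph := forall s : {set V}, s \in faces K -> (#|s| <= 2)%N.

Definition connected_complex :=
  (exists x : V, [set x]%SET \in faces K) /\
  (forall x y : V, [set x]%SET \in faces K -> [set y]%SET \in faces K ->
    connect adj x y).

Definition acyclic_graph :=
  forall c : seq V, (2 < size c)%N -> ~ ucycle adj c.

Definition is_tree := [/\ is_graph, connected_complex & acyclic_graph].

End Trees.

Section Morse.
Variables (V : finType) (K : simplicial_complex V).
Implicit Types W : {set {set V} * {set V}}.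

Definition discrete_vector_field W :=
  (forall p, p \in W -> facet K p.1 p.2) /\
  (forall s, s \in faces K ->
    (#|[set p in W | (p.1 == s) || (p.2 == s)]%SET| <= 1)%N).

(* The sequence a_0, b_0, a_1, ..., b_{k-1}, a_k is encoded by its first term
   a_0 and the list of steps (b_0, a_1), ..., (b_{k-1}, a_k). *)
Fixpoint vpath W (a : {set V}) (l : seq ({set V} * {set V})) : bool :=
  if l is (b, a') :: l' then
    [&& (a, b) \in W, facet K a' b, a' != a & vpath W a' l']
  else a \in faces K.

Definition gradient W :=
  discrete_vector_field W /\
  (forall a l, vpath W a l -> l != [::] -> last a (unzip2 l) <> a).

Lemma vpath_subset W1 W2 a l :
  W1 \subset W2 -> vpath W1 a l -> vpath W2 a l.
Proof.
move=> sW; elim: l a => [//|[b a'] l IHl] a /= /and4P[Wab fa' a'a /IHl ->].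
by rewrite (fintype.subsetP sW) ?fa' ?a'a.
Qed.

Lemma gradient_subset W1 W2 : W1 \subset W2 -> gradient W2 -> gradient W1.
Proof.
move=> sW [[fW uW] aW]; split; [split|].
- by move=> p /(fintype.subsetP sW)/fW.
- move=> s /uW; apply: leq_trans; apply/subset_leq_card/fintype.subsetP => p.
  by rewrite !inE => /andP[/(fintype.subsetP sW) -> ->].
- by move=> a l /(vpath_subset sW)/aW.
Qed.

Definition morse_faces : {set {set {set V} * {set V}}} :=
  [set W | (W != finset.set0) && `[< gradient W >]]%SET.

Lemma morse_faces_neq0 : finset.set0 \notin morse_faces.
Proof. by rewrite inE eqxx. Qed.

Lemma morse_faces_down (W1 W2 : {set {set V} * {set V}}) :
  W1 \in morse_faces -> W2 \subset W1 -> W2 != finset.set0 ->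
  W2 \in morse_faces.
Proof.
rewrite !inE => /andP[_ /asboolP gW] sW ->; apply/asboolP.
exact: gradient_subset sW gW.
Qed.

(* The primitive gradient vector field consisting of the single pair [p] is
   identified with [p], so the vertices are pairs. *)
Definition morse_complex :
    simplicial_complex (({set V} * {set V})%type : finType) :=
  SimplicialComplex morse_faces_neq0 morse_faces_down.

End Morse.

Local Open Scope classical_set_scope.

Section Topology.
Variable R : realType.

(* Barycentric coordinates. [K] is finite, so the topology induced from the
   product topology on [V -> R] is the usual one on the realization. *)
Definition realization (V : finType) (K : simplicial_complex V) :
    topologicalType :=
  set_type [set x : {ptws V -> R} |
    [/\ forall v, 0 <= x v, \sum_v x v = 1 &
        [set v | x v != 0]%SET \in faces K]].

Definition unit_itv : topologicalType := set_type `[0%R, 1%R : R]%classic.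

Lemma unit_itv0_subproof : (0 : R) \in `[0%R, 1%R : R]%classic.
Proof. by rewrite inE /= in_itv /= lexx ler01. Qed.

Lemma unit_itv1_subproof : (1 : R) \in `[0%R, 1%R : R]%classic.
Proof. by rewrite inE /= in_itv /= lexx ler01. Qed.

Definition itv_0 : unit_itv := exist _ (0 : R) unit_itv0_subproof.
Definition itv_1 : unit_itv := exist _ (1 : R) unit_itv1_subproof.

Definition homotopic (X Y : topologicalType) (f g : X -> Y) :=
  exists H : X * unit_itv -> Y,
    [/\ continuous H, forall x, H (x, itv_0) = f x
      & forall x, H (x, itv_1) = g x].

Definition homotopy_equivalent (X Y : topologicalType) :=
  exists (f : X -> Y) (g : Y -> X),
    [/\ continuous f, continuous g,
        homotopic (g \o f) idfun & homotopic (f \o g) idfun].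

Section Suspension.
Variable X : topologicalType.

(* The unreduced suspension is obtained from the disjoint union of the cylinder
   [X * [0, 1]] and two poles [false], [true] by gluing all [(x, 0)] to [false]
   and all [(x, 1)] to [true]. Keeping the poles as separate points only matters
   when [X] is empty, where it yields the 0-sphere. *)
Definition susp_piece (b : bool) : topologicalType :=
  if b then (X * unit_itv)%type : topologicalType else bool.

Definition pole (b : bool) : {i : bool & susp_piece i} :=
  existT susp_piece false b.

Definition cylinder (p : X * unit_itv) : {i : bool & susp_piece i} :=
  existT susp_piece true p.

Definition susp_collapse (u : {i : bool & susp_piece i}) :
    {i : bool & susp_piece i} :=
  match u with
  | existT true p =>
      if p.2 == itv_0 then pole false
      else if p.2 == itv_1 then pole true else cylinder p
  | existT false b => pole b
  end.

Definition susp_rel' : rel {i : bool & susp_piece i} :=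
  fun u v => susp_collapse u == susp_collapse v.

Lemma susp_rel_refl : reflexive susp_rel'.
Proof. by move=> u; exact: eqxx. Qed.

Lemma susp_rel_sym : symmetric susp_rel'.
Proof. by move=> u v; exact: eq_sym. Qed.

Lemma susp_rel_trans : transitive susp_rel'.
Proof. by move=> v u w /eqP uv; rewrite /susp_rel' uv. Qed.

Definition susp_rel := EquivRel _ susp_rel_refl susp_rel_sym susp_rel_trans.

Definition suspension : topologicalType := quotient_topology {eq_quot susp_rel}%qT.

End Suspension.
End Topology.

(* Main.v *)
Require Import Defs.
From mathcomp Require Import all_boot all_order all_algebra generic_quotient.
From mathcomp Require Import all_classical all_reals all_analysis.
From mathcomp Require Import ring lra.

Set Implicit Arguments.
Unset Strict Implicit.
Unset Printing Implicit Defensive.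

Import Order.TTheory GRing.Theory Num.Theory.
Import numFieldNormedType.Exports.

Local Open Scope ring_scope.
Local Open Scope classical_set_scope.

(** Let v be a leaf of T, with its only neighbour w and its only edge e = vw,
    and consider the two vertices a = ({v}, e) and b = ({w}, e) of the Morse
    complex M. A pair that shares a simplex with a must be b: nothing else
    can be matched with v or with e. Adding a to a gradient vector field that
    avoids b never creates a closed path either, because a path can enter v
    only through e, that is, only by using b ([gradient_leaf]). Hence every
    simplex of M without b spans a simplex together with a.

    So M is a union of two cones: the star of a contains all the faces without
    b, the star of b all the others, and the two stars meet in the link L of b,
    since a and b share e. It is therefore equivalent to the suspension of |L|
    ([susp_link]), with the barycentric coordinate x_b as the height.
    The maps are explicit. From |M| to the suspension, x goes to the class of
    (x - x_b b) / (1 - x_b) at height 3 x_b - 1, truncated to [0, 1]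
    ([to_susp]); backwards, the meridian through y goes to the broken line
    a -> y -> b ([from_susp]).

    - On |M|, a straight line from x to its image could leave M, since x may
      have b in its support and its image a. The two are joined through an
      intermediate point, the image of x under a map that pushes the points
      with x_b <= 1/2 off b ([fold_map]): each of the two segments lies in a
      face.
    - On the suspension, the composite only reparametrizes the meridians, by
      a map of [0, 1] that fixes both ends, so it is homotopic to the identity.
      Continuity of this homotopy on the product of the suspension (a quotient
      space) with [0, 1] comes from currying: a continuous map on
      X * [0, 1] * [0, 1] is a continuous map from X * [0, 1] to a function
      space with the compact-open topology, and that map can be descended to
      the quotient ([susp_homotopy]). *)

(** * Continuity of real functions *)

Lemma continuous_near_eq (X Y : topologicalType) (f g : X -> Y) (x : X) :
  {for x, continuous g} -> (\forall y \near x, f y = g y) ->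
  {for x, continuous f}.
Proof.
move=> gc fg U; rewrite /= (nbhs_singleton fg) => /gc.
by apply: filterS2 fg => y /= ->.
Qed.

Section RealContinuity.
Variables (R : realType) (Z : topologicalType).
Implicit Types (s t u x : Z -> R) (c d : R) (z : Z).

Lemma continuous_affine s c d z :
  {for z, continuous s} -> {for z, continuous (fun z => c * s z - d)}.
Proof.
move=> sc; apply: cvgB; last exact: cvg_cst.
by apply: cvgM; [exact: cvg_cst|exact: sc].
Qed.

Lemma continuous_div1B x s z :
  s z < 1 -> {for z, continuous x} -> {for z, continuous s} ->
  {for z, continuous (fun z => x z / (1 - s z))}.
Proof.
move=> s1 xc sc; apply: cvgM; first exact: xc.
apply: cvgV; first by rewrite subr_eq0 eq_sym lt_eqF.
by apply: cvgB; [exact: cvg_cst|exact: sc].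
Qed.

Lemma near_lt s c z :
  {for z, continuous s} -> s z < c -> \forall y \near z, s y < c.
Proof. by move=> sc szc; apply: (sc [set u | u < c]); exact: lt_nbhsl. Qed.

Lemma near_gt s c z :
  {for z, continuous s} -> c < s z -> \forall y \near z, c < s y.
Proof. by move=> sc szc; apply: (sc [set u | c < u]); exact: lt_nbhsr. Qed.

Lemma continuous_fold x s z :
  {for z, continuous x} -> {for z, continuous s} ->
  {for z, continuous (fun z => x z / Num.max (1/2) (1 - s z))}.
Proof.
move=> xc sc; apply: cvgM; first exact: xc.
apply: cvgV; first by rewrite gt_eqF// lt_max; apply/orP; left; lra.
apply: (@continuous_max R Z (cst (1/2)) (fun z => 1 - s z)).
  exact: cst_continuous.
by apply: cvgB; [exact: cvg_cst|exact: sc].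
Qed.

Lemma continuous_max0_affine s c d z :
  {for z, continuous s} ->
  {for z, continuous (fun z => Num.max 0 (c * s z - d))}.
Proof.
move=> sc; apply: (@continuous_max R Z (cst 0) (fun z => c * s z - d)).
  exact: cst_continuous.
exact: continuous_affine.
Qed.

Lemma continuous_lerp s t u z :
  {for z, continuous s} -> {for z, continuous t} -> {for z, continuous u} ->
  {for z, continuous (fun z => (1 - u z) * s z + u z * t z)}.
Proof.
move=> sc tc uc; apply: cvgD; apply: cvgM; [|exact: sc|exact: uc|exact: tc].
by apply: cvgB; [exact: cvg_cst|exact: uc].
Qed.

End RealContinuity.

(** * The unit interval *)

Section UnitInterval.
Variable R : realType.

Lemma clamp_subproof (x : R) :
  Num.max 0 (Num.min 1 x) \in `[0%R, 1%R : R]%classic.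
Proof. by rewrite inE /= in_itv /= le_max lexx ge_max ge_min lexx ler01. Qed.

Definition clamp (x : R) : unit_itv R :=
  exist _ (Num.max 0 (Num.min 1 x)) (clamp_subproof x).

Lemma unit_itv_inj (s t : unit_itv R) : sval s = sval t -> s = t.
Proof. exact: eq_sig_hprop. Qed.

Lemma unit_itv_ge0 (t : unit_itv R) : 0 <= sval t.
Proof. by case: t => t /=; rewrite inE /= in_itv /= => /andP[]. Qed.

Lemma unit_itv_le1 (t : unit_itv R) : sval t <= 1.
Proof. by case: t => t /=; rewrite inE /= in_itv /= => /andP[]. Qed.

Lemma unit_itv_continuous : continuous (sval : unit_itv R -> R).
Proof. exact: initial_continuous. Qed.

Lemma clamp_continuous : continuous clamp.
Proof.
apply: continuous_comp_initial => x.
apply: (@continuous_max R R (cst 0) (fun x => Num.min 1 x)).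
  exact: cst_continuous.
apply: (@continuous_min R R (cst 1) id); first exact: cst_continuous.
exact: id.
Qed.

Lemma clampK (t : unit_itv R) : clamp (sval t) = t.
Proof.
apply: unit_itv_inj => /=; rewrite (min_idPr (unit_itv_le1 t)).
exact/max_idPr/unit_itv_ge0.
Qed.

Lemma clamp_le0 (x : R) : x <= 0 -> clamp x = itv_0 R.
Proof.
move=> x0; apply: unit_itv_inj => /=; rewrite min_r ?max_l//.
exact: le_trans x0 ler01.
Qed.

Lemma clamp_ge1 (x : R) : 1 <= x -> clamp x = itv_1 R.
Proof. by move=> x1; apply: unit_itv_inj => /=; rewrite min_l// max_r. Qed.

Lemma clamp_le (x c : R) : 0 <= c -> x <= c -> sval (clamp x) <= c.
Proof. by move=> c0 xc; rewrite /= ge_max c0 ge_min xc orbT. Qed.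

Lemma clamp_ge (x c : R) : c <= 1 -> c <= x -> c <= sval (clamp x).
Proof. by move=> c1 cx; rewrite /= le_max le_min c1 cx orbT. Qed.

(** Compactness and the Hausdorff property serve the currying of homotopies on
    a suspension. *)
Lemma unit_itv_compact : compact [set: unit_itv R].
Proof.
have -> : [set: unit_itv R] = clamp @` `[0, 1].
  apply/seteqP; split=> // t _; exists (sval t); last exact: clampK.
  by rewrite /= in_itv /= unit_itv_ge0 unit_itv_le1.
apply: continuous_compact; last exact: segment_compact.
exact/continuous_subspaceT/clamp_continuous.
Qed.

Lemma unit_itv_hausdorff : hausdorff_space (unit_itv R).
Proof.
move=> s t st; apply/unit_itv_inj/(@Rhausdorff R).
move=> A B As Bt.
have [u [Au Bu]] := st _ _ (unit_itv_continuous As) (unit_itv_continuous Bt).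
by exists (sval u).
Qed.

Lemma unit_itv_locally_compact : locally_compact [set: unit_itv R].
Proof.
move=> t _; exists setT; first exact: filterT.
by split; [exact: unit_itv_compact | exact: closedT].
Qed.

End UnitInterval.

(** * Maps out of a suspension *)

Section SuspensionMaps.
Variables (R : realType) (X : topologicalType).
Local Notation SX := (suspension R X).

Definition susp_pole (b : bool) : SX := (\pi_SX (pole R X b))%qT.

Definition susp_point (p : X * unit_itv R) : SX := (\pi_SX (cylinder p))%qT.

Lemma susp_point_continuous : continuous susp_point.
Proof.
move=> p; apply: (@continuous_comp _ _ _ (@cylinder R X)).
  exact: (@existT_continuous bool (susp_piece R X) true).
exact: pi_continuous.
Qed.

Lemma susp_point0 x : susp_point (x, itv_0 R) = susp_pole false.
Proof.
by apply/eqmodP; rewrite /equiv /= /susp_rel' /= eqxx.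
Qed.

Lemma susp_point1 x : susp_point (x, itv_1 R) = susp_pole true.
Proof.
apply/eqmodP; rewrite /equiv /= /susp_rel' /= ifN ?eqxx//.
by apply/eqP => /(congr1 sval)/=/eqP; rewrite oner_eq0.
Qed.

Lemma susp_ind (P : SX -> Prop) :
  (forall b, P (susp_pole b)) -> (forall p, P (susp_point p)) -> forall z, P z.
Proof.
move=> Ppole Ppoint z; rewrite -[z]reprK.
by case: (repr z) => -[p|b]; [exact: Ppoint|exact: Ppole].
Qed.

(** The universal property of the suspension as a quotient. The values [p] at
    the poles are data because they are not determined by [h] when [X] is
    empty. *)
Lemma susp_rec (Z : topologicalType) (h : X * unit_itv R -> Z) (p : bool -> Z) :
  continuous h -> (forall x, h (x, itv_0 R) = p false) ->
  (forall x, h (x, itv_1 R) = p true) ->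
  exists g : SX -> Z, [/\ continuous g, forall b, g (susp_pole b) = p b &
    forall q, g (susp_point q) = h q].
Proof.
move=> hc h0 h1.
pose G (u : {i : bool & susp_piece R X i}) : Z :=
  match u with existT true q => h q | existT false b => p b end.
have Gcol u : G u = G (susp_collapse u).
  case: u => -[[x t]|b] //=; case: eqP => [->|_]; first by rewrite h0.
  by case: eqP => [->|_] //; rewrite h1.
have Gpi (u v : {i : bool & susp_piece R X i}) :
    \pi_SX%qT u = \pi_SX%qT v -> G u = G v.
  by move=> /eqmodP/eqP uv; rewrite Gcol uv -Gcol.
have Grepr u : G (repr (\pi_SX%qT u)) = G u by apply: Gpi; rewrite reprK.
exists (G \o repr); split => [|b|q].
- apply: repr_comp_continuous; last by move=> u v /eqP/Gpi ->.
  move=> [[] q] U GU; first exact: (hc q).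
  by apply: (@existT_continuous bool (susp_piece R X) false q);
    apply/principal_filterP; exact: nbhs_singleton GU.
- exact: Grepr.
- exact: Grepr.
Qed.

End SuspensionMaps.

Section SuspensionHomotopy.
Variables (R : realType) (X Z : topologicalType).
Import ArrowAsCompactOpen.

(** The product of a quotient map with the identity of [0, 1] is again a
    quotient map, which is not formal. Currying turns the claim into the
    universal property of the suspension for maps to the compact-open function
    space; going back requires [0, 1] to be locally compact and Hausdorff. *)
Lemma susp_homotopy (h : (X * unit_itv R) * unit_itv R -> Z)
    (p : bool -> unit_itv R -> Z) :
  continuous h -> (forall b, continuous (p b)) ->
  (forall x u, h ((x, itv_0 R), u) = p false u) ->
  (forall x u, h ((x, itv_1 R), u) = p true u) ->
  exists g : suspension R X * unit_itv R -> Z,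
    [/\ continuous g, forall b u, g (susp_pole R X b, u) = p b u &
      forall q u, g (susp_point q, u) = h (q, u)].
Proof.
move=> hc pc h0 h1; have [chc ch] := continuous_curry hc.
have ch0 x : curry h (x, itv_0 R) = p false by apply/funext => u; exact: h0.
have ch1 x : curry h (x, itv_1 R) = p true by apply/funext => u; exact: h1.
have [g [gc gpole gpoint]] := susp_rec chc ch0 ch1.
exists (uncurry g); split => [|b u|q u].
- apply: continuous_uncurry gc _; first exact: unit_itv_locally_compact.
    exact: unit_itv_hausdorff.
  by elim/susp_ind => [b|q]; [rewrite gpole|rewrite gpoint].
- by rewrite /uncurry /= gpole.
- by rewrite /uncurry /= gpoint.
Qed.

End SuspensionHomotopy.

(** * Maps into a realization *)

Section Realization.
Variables (R : realType) (V : finType) (K : simplicial_complex V).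
Local Notation "|K|" := (realization R K).

Definition bary (x : |K|) (v : V) : R := (sval x : V -> R) v.

Definition supp (x : |K|) : {set V} := [set v | bary x v != 0]%SET.

Lemma realizationP (x : |K|) :
  [/\ forall v, 0 <= bary x v, \sum_v bary x v = 1 & supp x \in faces K].
Proof. by rewrite /bary /supp; case: x => x /=; rewrite inE /=. Qed.

Lemma bary_ge0 x v : 0 <= bary x v. Proof. by case: (realizationP x). Qed.

Lemma bary_sum x : \sum_v bary x v = 1.
Proof. by case: (realizationP x). Qed.

Lemma supp_face x : supp x \in faces K. Proof. by case: (realizationP x). Qed.

Lemma mem_supp x v : (v \in supp x) = (bary x v != 0).
Proof. by rewrite inE. Qed.

Lemma sum_baryD1 x v : \sum_(w | w != v) bary x w = 1 - bary x v.
Proof.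
by have := bary_sum x; rewrite (bigD1 v)//= => <-; rewrite addrAC subrr add0r.
Qed.

Lemma realization_inj x y : bary x =1 bary y -> x = y.
Proof. by move=> /funext xy; exact: eq_sig_hprop. Qed.

Lemma realization_mk (x : V -> R) :
  (forall v, 0 <= x v) -> \sum_v x v = 1 ->
  (exists2 s, s \in faces K & forall v, x v != 0 -> v \in s) ->
  exists y : |K|, bary y = x.
Proof.
move=> x0 x1 [s sK xs].
pose D := [set y : {ptws V -> R} |
  [/\ forall v, 0 <= y v, \sum_v y v = 1 & [set v | y v != 0]%SET \in faces K]].
suff xD : (x : {ptws V -> R}) \in D.
  by exists (exist (fun y => y \in D) (x : {ptws V -> R}) xD).
rewrite inE; split=> //; apply: faces_down sK _ _.
  by apply/fintype.subsetP => v; rewrite inE => /xs.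
apply/negP => /eqP supp0; suff : (0 : R) == 1 by rewrite eq_sym oner_eq0.
rewrite -x1 big1// => v _; apply/eqP/negPn/negP => xv.
by have := finset.in_set0 v; rewrite -supp0 inE xv.
Qed.

Lemma bary_continuous v : continuous (bary ^~ v).
Proof.
move=> x.
apply: (@continuous_comp _ _ _ (sval : |K| -> {ptws V -> R}) (fun y => y v)).
  exact: initial_continuous.
exact: (@proj_continuous V (fun=> R) v).
Qed.

Lemma bary_comp_continuous (Z : topologicalType) (u : Z -> |K|) v :
  continuous u -> continuous (fun z => bary (u z) v).
Proof.
move=> uc z; have := continuous_comp (uc z) (@bary_continuous v (u z)); exact.
Qed.

(** The topology of a realization is initial for the barycentric coordinates. *)
Lemma continuous_realization_at (Z : topologicalType) (f : Z -> |K|) (z : Z) :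
  (forall v, {for z, continuous (fun z => bary (f z) v)}) ->
  {for z, continuous f}.
Proof.
move=> fc U [? /= [[W oW <-]]] /= Wfz /filterS; apply.
suff : (fun z => sval (f z) : {ptws V -> R}) @ z -->
    (sval (f z) : {ptws V -> R}).
  by apply; exact: open_nbhs_nbhs.
apply/cvg_sup => v B [? /= [[C oC <-]]] /= Cz /filterS; apply.
by apply: (fc v); exact: open_nbhs_nbhs.
Qed.

(** A continuous family of convex weights, each supported in some face, is a
    map to the realization. Choosing the face pointwise is enough. *)
Lemma realization_map (Z : topologicalType) (c : Z -> V -> R) :
  (forall z v, 0 <= c z v) -> (forall z, \sum_v c z v = 1) ->
  (forall z, exists2 s, s \in faces K & forall v, c z v != 0 -> v \in s) ->
  (forall v, continuous (c ^~ v)) ->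
  exists2 f : Z -> |K|, continuous f & forall z, bary (f z) = c z.
Proof.
move=> c0 c1 cK cc.
have [f fE] := choice (fun z => realization_mk (c0 z) (c1 z) (cK z)).
exists f => // z; apply: continuous_realization_at => v.
rewrite (_ : (fun z => _) = c ^~ v); first exact: cc.
by apply/funext => w; rewrite fE.
Qed.

End Realization.

Section BrokenLine.
Variable R : realType.

(** The polygonal path x -> y -> z, at y at time 1/2: the three weights are
    tent functions of t with sum 1. This formula, rather than one by cases,
    makes continuity and the sum of the coordinates immediate. *)
Definition broken (t x y z : R) : R :=
  Num.max 0 (1 - 2 * t) * x + Num.max 0 (2 * t - 1) * z +
  (1 - Num.max 0 (1 - 2 * t) - Num.max 0 (2 * t - 1)) * y.

Lemma broken_first t x y z : t <= 1/2 ->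
  broken t x y z = (1 - 2 * t) * x + 2 * t * y.
Proof.
by move=> t2; rewrite /broken max_r 1?max_l; [ring| |]; lra.
Qed.

Lemma broken_last t x y z : 1/2 <= t ->
  broken t x y z = (2 - 2 * t) * y + (2 * t - 1) * z.
Proof.
by move=> t2; rewrite /broken max_l 1?max_r; [ring| |]; lra.
Qed.

Lemma broken_ge0 (t : unit_itv R) x y z : 0 <= x -> 0 <= y -> 0 <= z ->
  0 <= broken (sval t) x y z.
Proof.
move=> x0 y0 z0; have t0 := unit_itv_ge0 t; have t1 := unit_itv_le1 t.
case: (lerP (sval t) (1/2)) => [t2|/ltW t2].
  by rewrite broken_first// addr_ge0// mulr_ge0//; lra.
by rewrite broken_last// addr_ge0// mulr_ge0//; lra.
Qed.

Lemma broken_continuous (Z : topologicalType) (t x y z : Z -> R) :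
  continuous t -> continuous x -> continuous y -> continuous z ->
  continuous (fun w => broken (t w) (x w) (y w) (z w)).
Proof.
move=> tc xc yc zc w.
have t1c : {for w, continuous (fun w => Num.max 0 (1 - 2 * t w))}.
  apply: (@continuous_max R Z (cst 0) (fun w => 1 - 2 * t w)).
    exact: cst_continuous.
  by apply: cvgB; [exact: cvg_cst | apply: cvgM; [exact: cvg_cst|exact: tc]].
have t2c : {for w, continuous (fun w => Num.max 0 (2 * t w - 1))}.
  apply: (@continuous_max R Z (cst 0) (fun w => 2 * t w - 1)).
    exact: cst_continuous.
  by apply: cvgB; [apply: cvgM; [exact: cvg_cst|exact: tc] | exact: cvg_cst].
apply: cvgD; first apply: cvgD.
- by apply: cvgM; [exact: t1c|exact: xc].
- by apply: cvgM; [exact: t2c|exact: zc].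
- apply: cvgM; last exact: yc.
  apply: cvgB; last exact: t2c.
  by apply: cvgB; [exact: cvg_cst|exact: t1c].
Qed.

Variables (V : finType) (K : simplicial_complex V) (Z : topologicalType).
Local Notation "|K|" := (realization R K).

(** Two maps to a realization are joined by a straight line as soon as their
    supports lie in a common face at every point. Two such lines are treated at
    once: this gives a homotopy from [p] to [r] through [q], and, for constant
    [p] and [r], the meridians of a suspension. *)
Lemma broken_line (p q r : Z -> |K|) :
  continuous p -> continuous q -> continuous r ->
  (forall z, exists2 s, s \in faces K & supp (p z) :|: supp (q z) \subset s) ->
  (forall z, exists2 s, s \in faces K & supp (q z) :|: supp (r z) \subset s) ->
  exists2 h : Z * unit_itv R -> |K|, continuous h &
    forall z t v, bary (h (z, t)) v =
      broken (sval t) (bary (p z) v) (bary (q z) v) (bary (r z) v).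
Proof.
move=> pc qc rc pqK qrK.
have [||||h hc hE] := @realization_map R V K (Z * unit_itv R)%type
  (fun zt v => broken (sval zt.2) (bary (p zt.1) v) (bary (q zt.1) v)
                      (bary (r zt.1) v)).
- by move=> zt v; apply: broken_ge0; exact: bary_ge0.
- move=> zt; rewrite /broken !big_split/= -!mulr_sumr !bary_sum; ring.
- move=> [z t] /=; case: (lerP (sval t) (1/2)) => [t2|/ltW t2].
    have [s sK /fintype.subsetP pqs] := pqK z; exists s => // v.
    rewrite broken_first// => pqv; apply: pqs; rewrite finset.in_setU !mem_supp.
    by apply: contraNT pqv; rewrite negb_or !negbK => /andP[/eqP -> /eqP ->];
      rewrite !mulr0 addr0.
  have [s sK /fintype.subsetP qrs] := qrK z; exists s => // v.
  rewrite broken_last// => qrv; apply: qrs; rewrite finset.in_setU !mem_supp.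
  by apply: contraNT qrv; rewrite negb_or !negbK => /andP[/eqP -> /eqP ->];
    rewrite !mulr0 addr0.
- move=> v.
  have fstc (u : Z -> |K|) :
      continuous u -> continuous (fun zt : Z * unit_itv R => u zt.1).
    move=> uc zt; apply: (@continuous_comp _ _ _ fst u); first exact: cvg_fst.
    exact: uc.
  apply: broken_continuous; last 3 first.
  - exact/bary_comp_continuous/fstc.
  - exact/bary_comp_continuous/fstc.
  - exact/bary_comp_continuous/fstc.
  move=> zt; have := continuous_comp (@cvg_snd Z (unit_itv R) _ _ _)
    (@unit_itv_continuous R zt.2); exact.
- by exists h => // z t v; rewrite hE.
Qed.

Lemma vertex_point (v : V) : [set v]%SET \in faces K ->
  exists y : |K|, forall w, bary y w = (w == v)%:R.
Proof.
move=> vK; have [|||y yE] := @realization_mk R V K (fun w => (w == v)%:R).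
- by move=> w; exact: ler0n.
- by rewrite (bigD1 v)//= eqxx big1 ?addr0// => w /negbTE ->.
- by exists [set v]%SET => // w; rewrite finset.inE pnatr_eq0 eqb0 negbK.
- by exists y => w; rewrite yE.
Qed.

End BrokenLine.

(** * Complexes covered by two stars *)

Section Link.
Variables (V : finType) (K : simplicial_complex V) (b : V).

Definition link_faces : {set {set V}} :=
  [set s : {set V} |
    [&& s != finset.set0, b \notin s & b |: s \in faces K]]%SET.

Lemma link_faces_neq0 : finset.set0 \notin link_faces.
Proof. by rewrite finset.inE eqxx. Qed.

Lemma link_faces_down (s t : {set V}) :
  s \in link_faces -> t \subset s -> t != finset.set0 -> t \in link_faces.
Proof.
rewrite !finset.inE => /and3P[_ bs sK] ts t0; apply/and3P; split => //.
  by apply: contra bs; exact: (fintype.subsetP ts).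
apply: faces_down sK (finset.setUS _ ts) _.
by apply/finset.set0Pn; exists b; rewrite setU11.
Qed.

Definition link : simplicial_complex V :=
  SimplicialComplex link_faces_neq0 link_faces_down.

End Link.

Section CollapseToLink.
Variables (R : realType) (V : finType) (K : simplicial_complex V) (b : V).
Local Notation "|K|" := (realization R K).
Local Notation "|L|" := (realization R (link K b)).

Lemma linkP s :
  reflect [/\ s != finset.set0, b \notin s & b |: s \in faces K]%SET
  (s \in faces (link K b)).
Proof. by rewrite finset.inE; exact: and3P. Qed.

Lemma bary_apex0 (y : |L|) : bary y b = 0.
Proof. by have /linkP[_] := supp_face y; rewrite mem_supp negbK => /eqP. Qed.

(** The radial projection from the vertex b onto its link, defined where
    0 < x_b < 1. *)
Definition link_proj (x : |K|) (v : V) : R :=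
  if v == b then 0 else bary x v / (1 - bary x b).

Lemma link_projP (x : |K|) : 0 < bary x b < 1 ->
  exists y : |L|, bary y = link_proj x.
Proof.
move=> /andP[xb0 xb1]; apply: realization_mk.
- move=> v; rewrite /link_proj; case: eqP => // _.
  by rewrite divr_ge0 ?bary_ge0// subr_ge0 ltW.
- rewrite (bigD1 b)//= {1}/link_proj eqxx add0r.
  rewrite (eq_bigr (fun v => bary x v / (1 - bary x b))); last first.
    by move=> v /negbTE vb; rewrite /link_proj vb.
  by rewrite -mulr_suml sum_baryD1 divff// subr_eq0 eq_sym lt_eqF.
- exists (supp x :\ b)%SET; last first.
    move=> v; rewrite /link_proj finset.in_setD1 mem_supp.
    case: (eqVneq v b); rewrite ?eqxx//=.
    by move=> _; apply: contraNneq => ->; rewrite mul0r.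
  apply/linkP; split; rewrite ?setD11//.
    apply/negP => /eqP supp0; have := sum_baryD1 x b; rewrite big1.
      by move/eqP; rewrite eq_sym subr_eq0 eq_sym lt_eqF.
    move=> v vb; apply/eqP/negPn/negP => xv.
    by have := finset.in_set0 v; rewrite -supp0 finset.in_setD1 vb mem_supp xv.
  by rewrite finset.setD1K ?supp_face// mem_supp gt_eqF.
Qed.

Lemma link_proj_at_continuous (x : |K|) v : bary x b < 1 ->
  {for x, continuous (fun x => link_proj x v)}.
Proof.
move=> xb1; rewrite /link_proj; case: eqP => _; first exact: cst_continuous.
exact: (continuous_div1B xb1 (@bary_continuous R V K v x)
  (@bary_continuous R V K b x)).
Qed.

(** The height 3 x_b - 1 is truncated to [0, 1], so that the map is constant
    near each pole. Its continuity there then does not depend on what the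
    neighbourhoods of a pole are, nor on the projection to the link, which is
    undefined at x_b = 0 and x_b = 1. Height 1/2 is reached exactly at
    x_b = 1/2, where [fold] also switches. *)
Lemma to_susp : exists f : |K| -> suspension R |L|,
  [/\ continuous f,
      forall x, bary x b <= 1/3 -> f x = susp_pole R |L| false,
      forall x, 2/3 <= bary x b -> f x = susp_pole R |L| true &
      forall x y, 0 < bary x b < 1 -> bary y = link_proj x ->
        f x = susp_point (y, clamp (3 * bary x b - 1))].
Proof.
have [r rE] : exists r : forall x : |K|, 0 < bary x b < 1 -> |L|,
    forall x h, bary (r x h) = link_proj x.
  exists (fun x h => projT1 (cid (link_projP h))) => x h.
  exact: projT2 (cid (link_projP h)).
pose f (x : |K|) := match pselect (0 < bary x b < 1) with
  | left h => susp_point (r x h, clamp (3 * bary x b - 1))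
  | right _ => susp_pole R |L| (1/2 < bary x b) end.
have fpoint x y : 0 < bary x b < 1 -> bary y = link_proj x ->
    f x = susp_point (y, clamp (3 * bary x b - 1)).
  move=> xb yx; rewrite /f; case: pselect => // h; congr (susp_point (_, _)).
  by apply: realization_inj => v; rewrite rE yx.
have f0 x : bary x b <= 1/3 -> f x = susp_pole R |L| false.
  move=> xb; rewrite /f; case: pselect => h.
    by rewrite clamp_le0 ?susp_point0//; lra.
  by congr (susp_pole _ _ _); apply/negbTE; rewrite -leNgt; lra.
have f1 x : 2/3 <= bary x b -> f x = susp_pole R |L| true.
  move=> xb; rewrite /f; case: pselect => h.
    by rewrite clamp_ge1 ?susp_point1//; lra.
  by congr (susp_pole _ _ _); lra.
have bc := @bary_continuous R V K b.
exists f; split=> // x.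
have [xb3|xb3] := ltP (bary x b) (1/3).
  apply: (continuous_near_eq (g := cst (susp_pole R |L| false))).
    exact: cst_continuous.
  by apply: filterS (near_lt (bc x) xb3) => y /ltW; exact: f0.
have [xb1|xb1] := ltP (2/3) (bary x b).
  apply: (continuous_near_eq (g := cst (susp_pole R |L| true))).
    exact: cst_continuous.
  by apply: filterS (near_gt (bc x) xb1) => y /ltW; exact: f1.
have xb : 0 < bary x b < 1 by lra.
(* To state its continuity at x, the projection is extended to a total map. Its
   value at x is the default: in general the link could be empty. *)
pose r' (y : |K|) := match pselect (0 < bary y b < 1) with
  | left h => r y h | right _ => r x xb end.
have nearb : \forall y \near x, 0 < bary y b < 1.
  case/andP: (xb) => xb0 xb1'.
  by apply: filterS2 (near_gt (bc x) xb0) (near_lt (bc x) xb1') => y -> ->.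
have r'E y : 0 < bary y b < 1 -> bary (r' y) = link_proj y.
  by rewrite /r'; case: pselect.
apply: (continuous_near_eq
  (g := fun y => susp_point (r' y, clamp (3 * bary y b - 1)))).
  have r'c : {for x, continuous r'}.
    apply: continuous_realization_at => v.
    apply: (continuous_near_eq (g := fun y => link_proj y v)).
      by apply: link_proj_at_continuous; have /andP[] := xb.
    by apply: filterS nearb => y /r'E ->.
  have tc : {for x, continuous (fun y => clamp (3 * bary y b - 1))}.
    have c3 : {for x, continuous (fun y : |K| => 3 * bary y b - 1)}.
      exact: continuous_affine (@bary_continuous R V K b x).
    exact: continuous_comp c3 (@clamp_continuous R _).
  apply: continuous_comp (@susp_point_continuous R |L| _).
  exact: cvg_pair r'c tc.
by apply: filterS nearb => y yb; apply: fpoint => //; exact: r'E.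
Qed.

End CollapseToLink.

Section Fold.
Variables (R : realType) (V : finType) (K : simplicial_complex V) (b : V).
Local Notation "|K|" := (realization R K).

(** Moves x away from b, along the line from b through x, until x_b has become
    max 0 (2 x_b - 1): the points with x_b <= 1/2 land in the faces without b.
    The denominator is 1 - x_b where x_b <= 1/2 and 1/2 elsewhere, hence never
    vanishes. *)
Definition fold (x : |K|) (v : V) : R :=
  if v == b then Num.max 0 (2 * bary x b - 1)
  else bary x v / Num.max (1/2) (1 - bary x b).

Lemma fold_low x v : bary x b <= 1/2 ->
  fold x v = if v == b then 0 else bary x v / (1 - bary x b).
Proof.
by move=> xb; rewrite /fold max_l 1?max_r; [case: eqP| |]; lra.
Qed.

Lemma fold_high x v : 1/2 <= bary x b ->
  fold x v = if v == b then 2 * bary x b - 1 else 2 * bary x v.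
Proof.
move=> xb; rewrite /fold max_r 1?max_l; [|lra|lra].
by case: eqP => // _; field.
Qed.

Lemma fold_supp x v : fold x v != 0 -> v \in supp x.
Proof.
rewrite mem_supp; apply: contraNneq => xv; apply/eqP.
case: (lerP (bary x b) (1/2)) => [xb|/ltW xb].
  by rewrite fold_low// xv mul0r if_same.
rewrite fold_high// xv mulr0; case: eqP => // vb.
by move: xb; rewrite -vb xv; lra.
Qed.

Lemma fold_map : exists2 phi : |K| -> |K|, continuous phi &
  forall x, bary (phi x) = fold x.
Proof.
apply: realization_map => [x v|x|x|v x].
- rewrite /fold; case: eqP => _; first by rewrite le_max lexx.
  by rewrite divr_ge0 ?bary_ge0// le_max; apply/orP; left; lra.
- rewrite (bigD1 b)//= {1}/fold eqxx.
  rewrite (eq_bigr (fun v => bary x v / Num.max (1/2) (1 - bary x b))).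
    2: by move=> v /negbTE vb; rewrite /fold vb.
  rewrite -mulr_suml sum_baryD1.
  case: (lerP (bary x b) (1/2)) => [xb|/ltW xb].
    by rewrite max_l 1?max_r ?add0r ?divff//; lra.
  by rewrite max_r 1?max_l; [field| |]; lra.
- by exists (supp x); [exact: supp_face|exact: fold_supp].
- rewrite /fold; case: eqP => _.
    exact: continuous_max0_affine (@bary_continuous R V K b x).
  exact: continuous_fold (@bary_continuous R V K v x)
    (@bary_continuous R V K b x).
Qed.

End Fold.

Section TwoStars.
Variables (R : realType) (V : finType) (K : simplicial_complex V) (a b : V).
Hypotheses (ab : a != b).
Hypotheses (aK : [set a]%SET \in faces K) (bK : [set b]%SET \in faces K).
Hypothesis coneK :
  forall s, s \in faces K -> b \notin s -> (a |: s)%SET \in faces K.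
Local Notation "|K|" := (realization R K).
Local Notation "|L|" := (realization R (link K b)).

Lemma link_cone s : s \in faces (link K b) -> (a |: s)%SET \in faces K.
Proof.
move=> /linkP[s0 bs bsK]; apply: coneK => //.
by apply: faces_down bsK _ s0; exact: finset.subsetUr.
Qed.

(** The meridian through y runs from a to y and then from y to b. Both segments
    lie in faces, by the cone hypothesis for the first and by definition of the
    link for the second. *)
Lemma from_susp : exists g : suspension R |L| -> |K|,
  [/\ continuous g,
      forall c v,
        bary (g (susp_pole R |L| c)) v = (v == if c then b else a)%:R &
      forall y t v, bary (g (susp_point (y, t))) v =
        broken (sval t) (v == a)%:R (bary y v) (v == b)%:R].
Proof.
have [A AE] := vertex_point R aK; have [B BE] := vertex_point R bK.
have [||||i ic iE] := @realization_map R V K |L| (fun y v => bary y v).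
- by move=> y v; exact: bary_ge0.
- by move=> y; exact: bary_sum.
- move=> y; exists (b |: supp y)%SET.
    by have /linkP[_ _] := supp_face y.
  by move=> v yv; rewrite !finset.inE yv orbT.
- by move=> v; exact: bary_continuous.
have suppi y : supp (i y) = supp y.
  by apply/finset.setP => v; rewrite !mem_supp iE.
have suppA : supp A = [set a]%SET.
  apply/finset.setP => v.
  by rewrite mem_supp AE finset.inE pnatr_eq0 eqb0 negbK.
have suppB : supp B = [set b]%SET.
  apply/finset.setP => v.
  by rewrite mem_supp BE finset.inE pnatr_eq0 eqb0 negbK.
have [|||||h hc hE] := @broken_line R V K |L| (cst A) i (cst B).
- exact: cst_continuous.
- exact: ic.
- exact: cst_continuous.
- move=> y; exists (a |: supp y)%SET; first exact/link_cone/supp_face.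
  by rewrite suppi suppA.
- move=> y; exists (b |: supp y)%SET; first by have /linkP[] := supp_face y.
  by rewrite suppi suppB finset.setUC.
have h0 y : h (y, itv_0 R) = A.
  apply: realization_inj => v; rewrite hE broken_first /=; last by lra.
  by rewrite !mulr0 subr0 mul1r mul0r addr0.
have h1 y : h (y, itv_1 R) = B.
  apply: realization_inj => v; rewrite hE broken_last /=; last by lra.
  by rewrite mulr1 subrr mul0r add0r -[X in X - 1]/(1 + 1) addrK mul1r.
have [g [gc gpole gpoint]] :=
  susp_rec (p := fun c => if c then B else A) hc h0 h1.
exists g; split=> //.
- by move=> [] v; rewrite gpole ?AE ?BE.
- by move=> y t v; rewrite gpoint hE AE BE iE.
Qed.

(** The complex is the union of the star of b and of the faces without b. The
    latter form a contractible cone with apex a, by [coneK], and collapsing it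
    leaves the star of b with its base, the link, shrunk to a point: the
    suspension of the link. *)
Lemma susp_link : homotopy_equivalent R |K| (suspension R |L|).
Proof.
have [f [fc f0 f1 fpoint]] := @to_susp R V K b.
have [g [gc gpole gpoint]] := from_susp.
have ba : (b == a) = false by rewrite eq_sym (negbTE ab).
have fgpole c : f (g (susp_pole R |L| c)) = susp_pole R |L| c.
  by case: c; [apply: f1|apply: f0]; rewrite gpole ?eqxx ?ba /=; lra.
(* The point at time t of a meridian has x_b = max 0 (2 t - 1), and
   3 (2 t - 1) - 1 = 6 t - 4. *)
have fgpoint y t :
    f (g (susp_point (y, t))) = susp_point (y, clamp (6 * sval t - 4)).
  have t1 := unit_itv_le1 t; have gb := gpoint y t b.
  rewrite ba eqxx bary_apex0 in gb.
  case: (lerP (sval t) (1/2)) => [t2|t2].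
    rewrite broken_first// in gb.
    by rewrite clamp_le0 ?susp_point0 ?f0// ?gb /=; lra.
  rewrite broken_last ?ltW// in gb.
  case: (ltP (sval t) 1) => [t1'|t1'].
    rewrite (fpoint _ y); first 1 last.
    - by rewrite gb /=; lra.
    - apply/funext => v; rewrite /link_proj; case: eqP => [->|/eqP/negbTE vb].
        exact: bary_apex0.
      rewrite gb gpoint vb broken_last ?ltW//=; field; lra.
    - by congr (susp_point (_, clamp _)); rewrite gb /=; lra.
  by rewrite clamp_ge1 ?susp_point1 ?f1// ?gb /=; lra.
exists f, g; split => //.
- have [phi phic phiE] := @fold_map R V K b.
  have [|||||H Hc HE] := @broken_line R V K |K| (g \o f) phi idfun.
  + by move=> x; apply: continuous_comp; [exact: fc|exact: gc].
  + exact: phic.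
  + by move=> x; exact: cvg_id.
  (* When x_b <= 1/2, g (f x) is on the first half of a meridian, and its
     support together with that of the folded point avoids b; otherwise both
     points lie in the face that supports x. *)
  + move=> x; have [xb0|xb0] := leP (bary x b) 0.
      have xb : bary x b = 0 by apply/le_anti; rewrite xb0 bary_ge0.
      exists (a |: supp x)%SET.
        by apply: coneK; [exact: supp_face|rewrite mem_supp xb eqxx].
      apply/fintype.subsetP => v; rewrite !finset.inE phiE => /orP[|/fold_supp].
        rewrite /= f0 ?xb; last by lra.
        by rewrite gpole pnatr_eq0 eqb0 negbK => ->.
      by rewrite finset.inE => ->; rewrite orbT.
    have [xb1|xb1] := ltP (bary x b) 1; last first.
      exists (supp x); first exact: supp_face.
      apply/fintype.subsetP => v.
      rewrite finset.in_setU !mem_supp phiE -!mem_supp.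
      move=> /orP[|/fold_supp//].
      rewrite mem_supp /= f1; last by lra.
      by rewrite gpole pnatr_eq0 eqb0 negbK => /eqP ->; rewrite mem_supp gt_eqF.
    have xb : 0 < bary x b < 1 by rewrite xb0.
    have [y yE] := link_projP xb.
    have gfE v : bary (g (f x)) v = broken (sval (clamp (3 * bary x b - 1)))
        (v == a)%:R (bary y v) (v == b)%:R by rewrite (fpoint _ y)// gpoint.
    case: (lerP (bary x b) (1/2)) => [xb2|xb2].
      exists (a |: supp y)%SET; first exact/link_cone/supp_face.
      apply/fintype.subsetP => v; rewrite !finset.inE phiE /= gfE.
      rewrite broken_first; last by apply: clamp_le; lra.
      rewrite fold_low// -[X in _ || (X != 0)]/(link_proj b x v) -yE.
      case: (v == a) => //=; rewrite mulr0 add0r => /orP[|//].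
      by rewrite mulf_eq0 negb_or => /andP[].
    exists (supp x); first exact: supp_face.
    apply/fintype.subsetP => v; rewrite finset.in_setU [X in X || _]mem_supp.
    rewrite [X in _ || X]mem_supp phiE => /orP[|/fold_supp//].
    apply: contraNT; rewrite mem_supp negbK => /eqP xv.
    have vb : (v == b) = false.
      by apply: contraTF xb0 => /eqP <-; rewrite xv ltxx.
    rewrite /= gfE broken_last; last by apply: clamp_ge; lra.
    by rewrite vb yE /link_proj vb xv mul0r !mulr0 addr0.
  + move=> x; exists (supp x); first exact: supp_face.
    rewrite finset.subUset fintype.subxx andbT; apply/fintype.subsetP => v.
    by rewrite mem_supp phiE; exact: fold_supp.
  + exists H; split => // x; apply: realization_inj => v; rewrite HE.
      by rewrite broken_first /=; lra.
    by rewrite broken_last /=; lra.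
- have [||||H [Hc Hpole Hpoint]] := @susp_homotopy R |L| (suspension R |L|)
    (fun ytu => susp_point (ytu.1.1, clamp ((1 - sval ytu.2) *
        sval (clamp (6 * sval ytu.1.2 - 4)) + sval ytu.2 * sval ytu.1.2)))
    (fun c _ => susp_pole R |L| c).
  + move=> w.
    have sndc (Y : topologicalType) (p : Y * unit_itv R) :
        {for p, continuous (fun p : Y * unit_itv R => sval p.2)}.
      exact: continuous_comp (@cvg_snd Y (unit_itv R) _ _ _)
        (@unit_itv_continuous R p.2).
    have fstc (Y Z : topologicalType) (p : Y * Z) :
        {for p, continuous (@fst Y Z)}.
      exact: cvg_fst.
    have tc := continuous_comp (fstc _ _ w) (sndc _ w.1).
    have kc := continuous_comp
      (continuous_comp (continuous_affine (c := 6) (d := 4) tc)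
         (@clamp_continuous R _)) (@unit_itv_continuous R _).
    have uc := continuous_comp (continuous_lerp kc tc (sndc _ w))
      (@clamp_continuous R _).
    have yc := continuous_comp (fstc _ _ w) (fstc _ _ w.1).
    exact: continuous_comp (cvg_pair yc uc) (@susp_point_continuous R |L| _).
  + by move=> c; exact: cst_continuous.
  + move=> y u /=; rewrite clamp_le0 ?susp_point0//.
    by rewrite max_l ?mulr0 ?addr0// ge_min; apply/orP; right; lra.
  + move=> y u /=; rewrite clamp_ge1 ?susp_point1//.
    by rewrite min_l ?max_r ?mulr1 ?subrK//; lra.
  + exists H; split => //; elim/susp_ind => [c|[y t]];
      rewrite ?Hpole ?Hpoint /=.
    * by rewrite fgpole.
    * rewrite fgpoint subr0 mul1r mul0r addr0.
      by rewrite (clampK (clamp (6 * sval t - 4)) : clamp (Num.max 0 _) = _).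
    * by [].
    * by rewrite subrr mul0r add0r mul1r clampK.
Qed.

End TwoStars.

(** * Leaves of forests *)

Section Leaf.
Variables (V : finType) (K : simplicial_complex V).

Lemma adj_sym : symmetric (adj K).
Proof. by move=> x y; rewrite /adj eq_sym finset.setUC. Qed.

(** Without leaves, every injective path could be extended at its start: a
    second neighbour of the first vertex is either new, or closes a cycle. *)
Lemma exists_leaf : acyclic_graph K -> has_edge K ->
  exists v w, adj K v w /\ forall u, adj K v u -> u = w.
Proof.
move=> acK [e eK /eqP/cards2P[x0 [y0 [xy0 eE]]]].
apply: contrapT => noleaf.
have next v w : adj K v w -> exists2 u, u != w & adj K v u.
  move=> vw; apply: contrapT => nou.
  apply: noleaf; exists v, w; split => // u vu.
  by apply/eqP/negPn/negP => uw; apply: nou; exists u.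
suff long n : exists x y p,
    [/\ uniq [:: x, y & p], path (adj K) x (y :: p) & size p = n].
  have [x [y [p [xyu _ sp]]]] := long #|V|.
  have := max_card [in [:: x, y & p]].
  by rewrite (card_uniqP xyu) /= sp ltnNge leqnSn.
elim: n => [|n [x [y [p [xyu xyp sp]]]]].
  by exists x0, y0, [::]; rewrite /= inE xy0 /adj xy0 -eE eK.
have /andP[xy _] : adj K x y && path (adj K) y p by [].
have [u uy xu] := next _ _ xy.
have xNu : u != x by rewrite eq_sym; case/andP: xu.
have ux : adj K u x by rewrite adj_sym.
have [up|uNp] := boolP (u \in p); last first.
  exists u, x, (y :: p); split; last by rewrite /= sp.
    by rewrite cons_uniq xyu andbT !inE !negb_or xNu uy uNp.
  by rewrite /= ux.
have [p1 [p2 pE]] : exists p1 p2, p = rcons p1 u ++ p2.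
  by case/splitPr: up => p1 p2; exists p1, p2; rewrite cat_rcons.
exfalso; apply: (acK [:: x, y & rcons p1 u]); first by rewrite /= size_rcons.
move: xyu xyp; rewrite pE -!cat_cons cat_uniq cat_path.
move=> /andP[cu _] /andP[cp _]; rewrite /ucycle cu andbT.
by rewrite /cycle rcons_path cp /= last_rcons ux.
Qed.

End Leaf.

(** * The Morse complex near a leaf *)

Section LeafPair.
Variables (V : finType) (K : simplicial_complex V).
Implicit Types W : {set {set V} * {set V}}.

Lemma gradient1 s t : facet K s t -> gradient K [set (s, t)]%SET.
Proof.
move=> st; split; first split.
- by move=> p; rewrite finset.inE => /eqP ->.
- move=> u _; rewrite -(cards1 (s, t)).
  apply/subset_leq_card/fintype.subsetP => p.
  by rewrite finset.inE => /andP[].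
- move=> x [//|[y z] l] /=.
  rewrite finset.inE => /and4P[/eqP[-> _] _ zs zl] _ lastl.
  case: l zl lastl => [_ /= /eqP|[y' z'] l /=]; first by apply/negP.
  by rewrite finset.inE => /and4P[/eqP[zs' _]]; rewrite zs' eqxx in zs.
Qed.

Variables (v w : V).
Hypotheses (dimK : is_graph K) (vw : adj K v w).
Hypothesis leaf : forall u, adj K v u -> u = w.
Let e : {set V} := [set v; w]%SET.

(** With the next three lemmas, this leaves ({v}, e) and ({w}, e) as the only
    pairs that contain {v} or e. *)
Lemma edge_facets (s : {set V}) :
  facet K s e = (s == [set v]%SET) || (s == [set w]%SET).
Proof.
have /andP[vw' eK] := vw.
have ce : #|e| = 2 by rewrite cards2 vw'.
apply/idP/orP.
  move=> /and4P[_ _ se]; rewrite ce eqSS => /eqP/esym/eqP/cards1P[x sE].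
  move: se; rewrite sE finset.sub1set !finset.inE.
  by move=> /orP[] /eqP ->; [left|right].
have xe x : x \in e -> facet K [set x]%SET e.
  move=> xe; rewrite /facet eK finset.sub1set xe cards1 ce eqxx !andbT.
  apply: faces_down eK _ _; first by rewrite finset.sub1set.
  by apply/finset.set0Pn; exists x; rewrite set11.
by case=> /eqP ->; apply: xe; rewrite !finset.inE eqxx ?orbT.
Qed.

Lemma leaf_coface (t : {set V}) : facet K [set v]%SET t -> t = e.
Proof.
move=> /and4P[_ tK vt]; rewrite cards1 => /cards2P[x [y [xy tE]]].
move: vt; rewrite finset.sub1set tE !finset.inE => /orP[] /eqP vE; subst.
  by rewrite /e -(leaf (u := y))// /adj xy.
by rewrite /e -(leaf (u := x)) 1?finset.setUC// /adj eq_sym xy finset.setUC.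
Qed.

Lemma facet_vertexN (s : {set V}) x : ~~ facet K s [set x]%SET.
Proof.
apply/negP => /and4P[sK _ _]; rewrite cards1 eqSS eq_sym cards_eq0 => /eqP s0.
by have := faces_neq0 K; rewrite -s0 sK.
Qed.

Lemma facet_edgeN (t : {set V}) : ~~ facet K e t.
Proof.
have /andP[vw' _] := vw.
by apply/negP => /and4P[_ /dimK + _ /eqP tE]; rewrite tE cards2 vw'.
Qed.

(** The pair ({v}, e) conflicts with ({w}, e) only. It creates no closed path:
    a path that arrives at v must have crossed e from w, which needs the pair
    ({w}, e); hence the new pair can only be the first step of a path, and such
    a path never returns to v. *)
Lemma gradient_leaf W : gradient K W -> ([set w], e)%SET \notin W ->
  gradient K (([set v]%SET, e) |: W)%SET.
Proof.
move=> [[fW uW] aW] bW.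
have ve : facet K [set v]%SET e by rewrite edge_facets eqxx.
have meet p : p \in W ->
    [|| p.1 == [set v]%SET, p.1 == e, p.2 == [set v]%SET | p.2 == e] ->
    p = ([set v]%SET, e).
  move=> pW; have := fW _ pW; case: p pW => s t pW /= st.
  move=> /or4P[] /eqP E; subst.
  - by rewrite (leaf_coface st).
  - by rewrite (negbTE (facet_edgeN t)) in st.
  - by rewrite (negbTE (facet_vertexN s v)) in st.
  - move: st; rewrite edge_facets => /orP[] /eqP E; subst=> //.
    by rewrite pW in bW.
split; first split.
- by move=> p; rewrite !finset.inE => /orP[/eqP ->|/fW].
- move=> s sK; have [se|se] := boolP ((s == [set v]%SET) || (s == e)).
    rewrite -(cards1 ([set v]%SET, e)).
    apply/subset_leq_card/fintype.subsetP => p.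
    rewrite !finset.inE => /andP[/orP[//|pW]] ps; apply/eqP/meet => //.
    by case/orP: se => /eqP se; case/orP: ps => /eqP ps;
      rewrite ps se eqxx ?orbT.
  apply: leq_trans (uW _ sK); apply/subset_leq_card/fintype.subsetP => p.
  rewrite !finset.inE => /andP[/orP[/eqP ->|-> //]] /=.
  by rewrite !(eq_sym _ s) (negbTE se).
have enter x l : vpath K (([set v]%SET, e) |: W)%SET x l -> l != [::] ->
    last x (unzip2 l) != [set v]%SET.
  elim: l x => // -[y z] l IHl x /= /and4P[xy zy zx zl] _.
  case: l IHl zl => [_ _|yz l IHl zl]; last exact: IHl.
  apply/eqP => /= zv; move: zy; rewrite zv => /leaf_coface ye.
  move: xy; rewrite !finset.inE ye => /orP[/eqP[xv]|xW].
    by rewrite zv xv eqxx in zx.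
  have := fW _ xW; rewrite edge_facets /= => /orP[] /eqP xE.
    by rewrite zv xE eqxx in zx.
  by rewrite -xE xW in bW.
have stay x l : vpath K (([set v]%SET, e) |: W)%SET x l -> x != [set v]%SET ->
    vpath K W x l.
  elim: l x => // -[y z] l IHl x /= /and4P[xy zy zx zl] xv.
  have zv : z != [set v]%SET.
    by apply: (enter x [:: (y, z)]); rewrite //= xy zy zx /=; case/and3P: zy.
  rewrite zy zx IHl// !andbT; move: xy.
  rewrite !finset.inE => /orP[/eqP[xE _]|//].
  by rewrite xE eqxx in xv.
move=> x l xl l0; have [xv|xv] := eqVneq x [set v]%SET.
  by move=> lx; have := enter _ _ xl l0; rewrite lx xv eqxx.
exact: aW (stay _ _ xl xv) l0.
Qed.

End LeafPair.

Theorem proposition12 (R : realType) (V : finType) (T : simplicial_complex V)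
    (treeT : is_tree T) (edgeT : has_edge T) :
  exists X : topologicalType,
    homotopy_equivalent R (realization R (morse_complex T)) (suspension R X).
Proof.
have [dimT _ acT] := treeT.
have [v [w [vw leaf]]] := exists_leaf acT edgeT.
pose a : {set V} * {set V} := ([set v]%SET, [set v; w]%SET).
pose b : {set V} * {set V} := ([set w]%SET, [set v; w]%SET).
exists (realization R (link (morse_complex T) b)).
have fa : facet T a.1 a.2 by rewrite edge_facets// eqxx.
have fb : facet T b.1 b.2 by rewrite edge_facets// eqxx orbT.
have set1_neq0 (p : {set V} * {set V}) : [set p]%SET != finset.set0.
  by apply/finset.set0Pn; exists p; rewrite set11.
apply: (@susp_link R _ (morse_complex T) a b).
- case/andP: vw => vw _; apply: contra vw => /eqP[/setP/(_ v)].
  by rewrite !finset.inE eqxx => /esym.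
- by rewrite finset.inE set1_neq0; apply/asboolP/gradient1.
- by rewrite finset.inE set1_neq0; apply/asboolP/gradient1.
- move=> s; rewrite !finset.inE => /andP[_ /asboolP gs] bs; apply/andP; split.
    by apply/finset.set0Pn; exists a; rewrite setU11.
  exact/asboolP/gradient_leaf.
Qed.
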